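(* Let $X$ and $Y$ be Banach spaces and let $T\in L(X)$, $C\in L(X,Y)$, $B\in L(Y,X)$ be such that $C$ is surjective, $B$ is injective and $T=BC$. Suppose that the Moore-Penrose inverse $T^{\dag}$ exists. Let $I\in L(X)$ be the identity map. Then each one of the following statements is necessary and sufficient for $T$ to be EP: (i) $(I-C^{\dag}C)B=0$ and $C(I-BB^{\dag})=0$; (ii) $B^{\dag}(I-C^{\dag}C)=0$ and $C(I-BB^{\dag})=0$; (iii) $(I-C^{\dag}C)B=0$ and $(I-BB^{\dag})C^{\dag}=0$; (iv) $B^{\dag}(I-C^{\dag}C)=0$ and $(I-BB^{\dag})C^{\dag}=0$; (v) $C(I-BB^{\dag})=0$ and $B^{\dag}(I-C^{\dag}C)B=0$; (vi) $B^{\dag}(I-C^{\dag}C)=0$ and $C(I-BB^{\dag})C^{\dag}=0$.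
   Context: Banach spaces are complex; $L(X,Y)$ is the space of bounded linear maps $X\to Y$, $L(X)=L(X,X)$. An operator $S\in L(X)$ is hermitian if $\|\exp(itS)\|=1$ for all $t\in\mathbb{R}$ (on the zero space, the unique operator is regarded as hermitian). An operator $T\in L(X,Y)$ is Moore-Penrose invertible if there is $S\in L(Y,X)$ with $T=TST$, $S=STS$, and $ST\in L(X)$, $TS\in L(Y)$ hermitian; such $S$ is unique and is denoted $T^{\dag}$. An operator $T\in L(X)$ is EP if $T^{\dag}$ exists and $TT^{\dag}=T^{\dag}T$. Under the hypotheses of the claim the Moore-Penrose inverses $B^{\dag}\in L(X,Y)$ and $C^{\dag}\in L(Y,X)$ exist. *)

(* Defs.v *)
From HB Require Import structures.
From mathcomp Require Import all_boot all_order all_algebra.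
From mathcomp Require Import all_classical all_reals all_analysis.
From mathcomp Require Import complex.

Set Implicit Arguments.
Unset Strict Implicit.
Unset Printing Implicit Defensive.

Import Order.TTheory GRing.Theory Num.Theory.
Import numFieldNormedType.Exports.

Local Open Scope classical_set_scope.
Local Open Scope ring_scope.
Local Open Scope complex_scope.

Reserved Notation "S *o T" (at level 40, left associativity).

(* The norm of a complex normed space takes values in R[i]; this is the same
   norm, as a real number. *)
Definition rnorm (R : realType) (V : normedModType R[i]) (x : V) : R :=
  complex.Re `|x|.

Section RealNorm.
Context (R : realType) (V : normedModType R[i]).
Implicit Types x y : V.

Lemma rnormE x : `|x| = (rnorm x)%:C.
Proof. by rewrite /rnorm RRe_real// normr_real. Qed.

Lemma rnorm_ge0 x : 0 <= rnorm x.
Proof. by rewrite -ler0c -rnormE. Qed.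

Lemma rnormD x y : rnorm (x + y) <= rnorm x + rnorm y.
Proof. by rewrite -lecR rmorphD/= -!rnormE ler_normD. Qed.

Lemma rnormZ (l : R[i]) x : rnorm (l *: x) = complex.Re `|l| * rnorm x.
Proof.
apply: complexI; rewrite (rmorphM (real_complex R)).
rewrite -[X in _ * X]rnormE -rnormE normrZ.
by congr (_ * _); apply/esym/RRe_real; rewrite normr_real.
Qed.

Lemma rnorm0 : rnorm (0 : V) = 0.
Proof. by rewrite /rnorm normr0. Qed.

Lemma rnorm_eq0 x : rnorm x = 0 -> x = 0.
Proof. by move=> x0; apply: normr0_eq0; rewrite rnormE x0. Qed.

End RealNorm.

Definition bounded_linear (R : realType) (X Y : normedModType R[i])
    (f : X -> Y) : Prop :=
  linear f /\ exists M : R, forall x, rnorm (f x) <= M * rnorm x.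

Definition bounded_linear_pred (R : realType) (X Y : normedModType R[i])
  : {pred X -> Y} := [pred f | `[< bounded_linear f >]].

Lemma bounded_linear_submod (R : realType) (X Y : normedModType R[i]) :
  submod_closed (@bounded_linear_pred R X Y).
Proof.
split=> [|a f g].
  apply/asboolP; split=> [b x y|]; first by rewrite scaler0 addr0.
  by exists 0 => x; rewrite rnorm0 mul0r.
move=> /asboolP[lf [M hM]] /asboolP[lg [N hN]]; apply/asboolP; split.
  move=> b x y; rewrite /= !fctE lf lg !scalerDr !scalerA (mulrC b a).
  by rewrite addrACA.
exists (complex.Re `|a| * M + N) => x; rewrite /= !fctE.
rewrite (le_trans (rnormD _ _))// mulrDl lerD// rnormZ -mulrA ler_wpM2l//.
by rewrite -ler0c RRe_real// normr_real.
Qed.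

HB.instance Definition _ (R : realType) (X Y : normedModType R[i]) :=
  GRing.isSubmodClosed.Build R[i] (X -> Y) (@bounded_linear_pred R X Y)
    (bounded_linear_submod X Y).

(* L(X, Y) *)
Record blin (R : realType) (X Y : normedModType R[i]) := BLin {
  blin_fun :> X -> Y;
  _ : blin_fun \in @bounded_linear_pred R X Y }.

Section BLinLmodule.
Context (R : realType) (X Y : normedModType R[i]).

HB.instance Definition _ := [isSub for @blin_fun R X Y].
HB.instance Definition _ := [Choice of blin X Y by <:].
HB.instance Definition _ := [SubChoice_isSubLmodule of blin X Y by <:].

End BLinLmodule.

Section OperatorNorm.
Context (R : realType) (X Y : normedModType R[i]).
Implicit Types S T : blin X Y.

Lemma blinP T : bounded_linear T.
Proof. by case: T => f /= /asboolP. Qed.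

Lemma blin_ext S T : S =1 T -> S = T.
Proof. by move=> ST; apply/val_inj/funext. Qed.

Lemma blinDE S T x : (S + T) x = S x + T x. Proof. by []. Qed.
Lemma blinZE (a : R[i]) T x : (a *: T) x = a *: T x. Proof. by []. Qed.
Lemma blin0E x : (0 : blin X Y) x = 0. Proof. by []. Qed.

Definition opnorm T : R := sup [set rnorm (T x) | x in [set x | rnorm x <= 1]].

Lemma opnorm_has_sup T :
  has_sup [set rnorm (T x) | x in [set x | rnorm x <= 1]].
Proof.
split; first by exists (rnorm (T 0)), 0 => //=; rewrite rnorm0.
have [_ [M hM]] := blinP T; exists `|M| => _ [x /= x1 <-].
rewrite (le_trans (hM x))// (le_trans (ler_norm _))// normrM.
by rewrite (ger0_norm (rnorm_ge0 x)) ler_piMr.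
Qed.

Lemma blin0 T : T 0 = 0.
Proof.
have [lT _] := blinP T.
by have := lT (-1) 0 0; rewrite !scaleN1r oppr0 addr0 addNr.
Qed.

Lemma blinZ T (a : R[i]) x : T (a *: x) = a *: T x.
Proof. by have [lT _] := blinP T; rewrite -[a *: x]addr0 lT blin0 addr0. Qed.

Lemma opnorm_ub T x : rnorm x <= 1 -> rnorm (T x) <= opnorm T.
Proof.
by move=> x1; apply: (ub_le_sup (opnorm_has_sup T).2); exists x.
Qed.

Lemma opnorm_lub T M :
  (forall x, rnorm x <= 1 -> rnorm (T x) <= M) -> opnorm T <= M.
Proof.
move=> hM; apply: ge_sup; first exact: (opnorm_has_sup T).1.
by move=> _ [x /= x1 <-]; exact: hM.
Qed.

Lemma opnorm_ge0 T : 0 <= opnorm T.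
Proof.
by rewrite (le_trans (rnorm_ge0 (T 0)))// opnorm_ub// rnorm0.
Qed.

Lemma opnormP T x : rnorm (T x) <= opnorm T * rnorm x.
Proof.
have [->|x0] := eqVneq x 0; first by rewrite blin0 !rnorm0 mulr0.
have nx0 : 0 < rnorm x.
  rewrite lt_neqAle rnorm_ge0 andbT eq_sym.
  by apply: contra x0 => /eqP /rnorm_eq0 /eqP.
have Rl : complex.Re `|(rnorm x)^-1%:C| = (rnorm x)^-1.
  by rewrite ger0_norm// ler0c invr_ge0 ltW.
have : rnorm (T ((rnorm x)^-1%:C *: x)) <= opnorm T.
  by rewrite opnorm_ub// rnormZ Rl mulVf// gt_eqF.
by rewrite blinZ rnormZ Rl ler_pdivrMl// mulrC.
Qed.

Let normL T : R[i] := (opnorm T)%:C.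

Let normLD S T : normL (S + T) <= normL S + normL T.
Proof.
rewrite /normL -(rmorphD (real_complex R)) lecR; apply: opnorm_lub => x x1.
by rewrite blinDE (le_trans (rnormD _ _))// lerD// opnorm_ub.
Qed.

Let normLZ (a : R[i]) T : normL (a *: T) = `|a| * normL T.
Proof.
have key (b : R[i]) S : opnorm (b *: S) <= complex.Re `|b| * opnorm S.
  apply: opnorm_lub => x x1; rewrite blinZE rnormZ ler_wpM2l ?opnorm_ub//.
  by rewrite -ler0c RRe_real// normr_real.
have -> : `|a| = (complex.Re `|a|)%:C by rewrite RRe_real// normr_real.
rewrite /normL -(rmorphM (real_complex R)); congr (_%:C).
apply/eqP; rewrite eq_le key andTb.
have [->|a0] := eqVneq a 0; first by rewrite normr0 mul0r opnorm_ge0.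
have na0 : 0 < complex.Re `|a|.
  by rewrite -ltcR RRe_real ?normr_real// normr_gt0.
rewrite -ler_pdivlMl//; have := key a^-1 (a *: T).
rewrite scalerA mulVf// scale1r => /le_trans; apply.
suff -> : complex.Re `|a^-1| = (complex.Re `|a|)^-1 by [].
apply: complexI; rewrite (fmorphV (real_complex R)).
by rewrite !RRe_real ?normr_real// normfV.
Qed.

Let normL0_eq0 T : normL T = 0 -> T = 0.
Proof.
move=> /complexI T0; apply: blin_ext => x; apply: rnorm_eq0.
by apply/eqP; rewrite eq_le rnorm_ge0 andbT -[leRHS](mul0r (rnorm x)) -T0 opnormP.
Qed.

HB.instance Definition _ :=
  Lmodule_isNormed.Build R[i] (blin X Y) normLD normLZ normL0_eq0.

Lemma blin_normE T : `|T| = (opnorm T)%:C.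
Proof. by []. Qed.

End OperatorNorm.

Lemma id_bounded_linear (R : realType) (X : normedModType R[i]) :
  (idfun : X -> X) \in @bounded_linear_pred R X X.
Proof.
by apply/asboolP; split=> [//|]; exists 1 => x; rewrite mul1r.
Qed.

Definition idL (R : realType) (X : normedModType R[i]) : blin X X :=
  BLin (id_bounded_linear X).

Lemma comp_bounded_linear (R : realType) (X Y Z : normedModType R[i])
    (S : blin Y Z) (T : blin X Y) :
  (fun x => S (T x)) \in @bounded_linear_pred R X Z.
Proof.
have [lS _] := blinP S; have [lT _] := blinP T; apply/asboolP; split.
  by move=> a x y; rewrite lT lS.
exists (opnorm S * opnorm T) => x.
by rewrite (le_trans (opnormP _ _))// -mulrA ler_wpM2l ?opnorm_ge0 ?opnormP.
Qed.

Definition compL (R : realType) (X Y Z : normedModType R[i])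
    (S : blin Y Z) (T : blin X Y) : blin X Z := BLin (comp_bounded_linear S T).

Notation "S *o T" := (compL S T) : ring_scope.

Definition powL (R : realType) (X : normedModType R[i]) (T : blin X X)
  (n : nat) : blin X X := iter n (compL T) (idL X).

(* The limit is taken in the operator norm of L(X); the series converges
   (absolutely) as soon as X is complete. *)
Definition expL (R : realType) (X : normedModType R[i]) (T : blin X X)
    : blin X X :=
  limn (series (fun n => (n`!%:R)^-1 *: powL T n)).

(* The first disjunct is the convention for the zero space, on which every
   operator has norm 0. *)
Definition hermitian_op (R : realType) (X : normedModType R[i]) (S : blin X X)
    : Prop :=
  (forall x : X, x = 0) \/
  forall t : R, `| expL ((0 +i* t) *: S) | = 1.

Definition is_mpinv (R : realType) (X Y : normedModType R[i])
    (T : blin X Y) (S : blin Y X) : Prop :=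
  [/\ T = T *o S *o T, S = S *o T *o S, hermitian_op (S *o T)
    & hermitian_op (T *o S)].

Definition mp_invertible (R : realType) (X Y : normedModType R[i])
    (T : blin X Y) : Prop := exists S, is_mpinv T S.

(* The Moore-Penrose inverse, by convention 0 if there is none. *)
Definition mpinv (R : realType) (X Y : normedModType R[i]) (T : blin X Y)
    : blin Y X := xget 0 [set S | is_mpinv T S].

Definition EP (R : realType) (X : normedModType R[i]) (T : blin X X) : Prop :=
  mp_invertible T /\ T *o mpinv T = mpinv T *o T.

(* Main.v *)
(* Injectivity of B and surjectivity of C turn T T^+ T = T into C T^+ B = 1, so
   C T^+ and T^+ B are Moore-Penrose inverses of B and C, and B^+ B = 1 = C C^+.
   Hence T^+ = C^+ B^+, and T is EP exactly when the hermitian idempotents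
   P = B B^+ = T T^+ and Q = C^+ C = T^+ T coincide. Each of (i)-(vi) says in
   terms of P and Q that they coincide, or that they have the same range
   (PQ = Q, QP = P) or the same kernel (PQ = P, QP = Q).

   Hermitian idempotents with the same range or kernel are equal, which also
   gives the uniqueness of Moore-Penrose inverses. Indeed
   exp(itP) = (1 - P) + e^{it} P, so at t = pi the reflections 1 - 2P and 1 - 2Q
   are contractions. One of their two products is 1 + 2(P - Q), and
   (P - Q)^2 = 0. *)
Require Import Defs.
From mathcomp Require Import all_boot all_order all_algebra.
From mathcomp Require Import all_classical all_reals all_analysis.
From mathcomp Require Import complex.
From mathcomp Require Import ring.
Import Order.TTheory GRing.Theory Num.Theory numFieldNormedType.Exports.

Local Open Scope classical_set_scope.
Local Open Scope ring_scope.
Local Open Scope complex_scope.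

(** * The exponential series at imaginary arguments *)

Lemma real_complex_cvg (R : realType) (u : nat -> R) (l : R) :
  u @ \oo --> l -> (fun n => (u n)%:C) @ \oo --> (l%:C : (R[i] : numFieldType)).
Proof.
move=> ul; apply/(@cvgrPdist_lt _ (R[i] : numFieldType)) => e e0.
have eE : e = (complex.Re e)%:C by rewrite RRe_real// gtr0_real.
have e0' : 0 < complex.Re e by rewrite -ltcR -eE.
move/cvgrPdist_lt : ul => /(_ _ e0'); apply: filterS => n.
rewrite eE -(rmorphB (real_complex R)) => un.
by rewrite normc_def /= expr0n /= addr0 sqrtr_sqr ltcR.
Qed.

(** Since i^(2m) = (-1)^m, even powers feed only the cosine and odd powers only the sine. *)
Lemma expi_coeffE (R : realType) (t : R) n :
  (n`!%:R)^-1 * (0 +i* t) ^+ n =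
  (cos_coeff t n)%:C + 'i * (sin_coeff t n)%:C :> R[i].
Proof.
have tE : 0 +i* t = 'i * t%:C :> R[i] by simpc.
have iE m : 'i ^+ m.*2 = ((-1) ^+ m)%:C :> R[i].
  by rewrite -mul2n exprM sqr_i (rmorphXn (real_complex R)) /= rmorphN1.
have fE : (n`!%:R)^-1 = ((n`!%:R : R)^-1)%:C :> R[i].
  by rewrite (fmorphV (real_complex R)) rmorph_nat.
rewrite tE exprMn fE -(rmorphXn (real_complex R)).
rewrite -[in 'i ^+ n](odd_double_half n) exprD iE.
rewrite /cos_coeff /sin_coeff /=.
case: (odd n) (odd_double_half n) => /= nE.
  (* [sin_coeff] halves n - 1, which for odd n has the same integer half as n. *)
  have -> : n.-1./2 = n./2 by rewrite -[in LHS]nE add1n /= doubleK.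
  by rewrite expr1 !mul0r !mul1r add0r !rmorphM /=; ring.
by rewrite expr0 !mul0r !mul1r mulr0 addr0 !rmorphM /=; ring.
Qed.

Lemma series_expi_cvg (R : realType) (t : R) :
  series (fun n => (n`!%:R)^-1 * (0 +i* t) ^+ n) @ \oo -->
    (cos t +i* sin t : (R[i] : numFieldType)).
Proof.
have -> : series (fun n => (n`!%:R)^-1 * (0 +i* t) ^+ n) =
    (fun n => (series (cos_coeff t) n)%:C + 'i * (series (sin_coeff t) n)%:C)
    :> (nat -> R[i]).
  apply/funext => n; rewrite /series /= !(rmorph_sum (real_complex R)).
  rewrite mulr_sumr -big_split /=.
  by apply: eq_bigr => k _; rewrite expi_coeffE.
have -> : cos t +i* sin t = (cos t)%:C + 'i * (sin t)%:C by simpc.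
apply: (@cvgD _ (R[i] : numFieldType)).
  (* [cos] unfolds to the limit of this very series, so only convergence is left; likewise for
     [sin]. *)
  by apply: real_complex_cvg; rewrite unlock; exact: is_cvg_series_cos_coeff.
apply: (@cvgMl_tmp (R[i] : numFieldType)).
by apply: real_complex_cvg; rewrite unlock; exact: is_cvg_series_sin_coeff.
Qed.

Lemma normc_expi (R : realType) (t : R) : `|cos t +i* sin t| = 1.
Proof. by rewrite normc_def /= cos2Dsin2 sqrtr1. Qed.

(** * Algebra of bounded operators *)

Lemma blinD {R : realType} {X Y : normedModType R[i]} (T : blin X Y) x y :
  T (x + y) = T x + T y.
Proof. by have [lT _] := blinP T; have := lT 1 x y; rewrite !scale1r. Qed.

Lemma blinB {R : realType} {X Y : normedModType R[i]} (T : blin X Y) x y :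
  T (x - y) = T x - T y.
Proof. by rewrite blinD -scaleN1r blinZ scaleN1r. Qed.

Section Algebra.
Context {R : realType} {X Y Z W : normedModType R[i]}.

Lemma compLA (S : blin Z W) (T : blin Y Z) (U : blin X Y) :
  S *o (T *o U) = S *o T *o U.
Proof. exact: blin_ext. Qed.

Lemma compLE (S : blin Y Z) (T : blin X Y) x : (S *o T) x = S (T x).
Proof. by []. Qed.

Lemma comp1L (T : blin X Y) : idL Y *o T = T.
Proof. exact: blin_ext. Qed.

Lemma compL1 (T : blin X Y) : T *o idL X = T.
Proof. exact: blin_ext. Qed.

Lemma compLBl (S T : blin Y Z) (U : blin X Y) :
  (S - T) *o U = S *o U - T *o U.
Proof. exact: blin_ext. Qed.

Lemma compLBr (S : blin Y Z) (T U : blin X Y) :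
  S *o (T - U) = S *o T - S *o U.
Proof. by apply: blin_ext => x; exact: blinB. Qed.

End Algebra.

(** * Hermitian idempotents *)

Section Hermitian.
Context {R : realType} {X : normedModType R[i]}.
Implicit Types P Q N S T : blin X X.

(** Powers of P are P except at n = 0, where the last term corrects P to the identity. *)
Lemma powLZ_idem (z : R[i]) P n : P *o P = P ->
  powL (z *: P) n = z ^+ n *: P + (n == 0)%:R *: (idL X - P).
Proof.
move=> PP; elim: n => [|n IHn].
  by rewrite !scale1r addrC subrK.
rewrite /powL iterS -/(powL _ n) IHn scale0r addr0.
apply: blin_ext => x; rewrite compLE.
have PPx y : P (P y) = P y by rewrite -[in RHS]PP.
rewrite -[LHS]/(z *: P (z ^+ n *: P x + (n == 0)%:R *: (x - P x))).
rewrite -[RHS]/(z ^+ n.+1 *: P x).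
rewrite blinD !blinZ blinB PPx subrr scaler0 addr0.
by rewrite scalerA exprS.
Qed.

Lemma expL_idem (t : R) P : P *o P = P ->
  expL ((0 +i* t) *: P) = (idL X - P) + (cos t +i* sin t) *: P.
Proof.
move=> PP; apply: cvg_lim; first exact: norm_hausdorff.
(* The correction from index 0 occurs only in nonempty partial sums, hence the shift by one. *)
rewrite -cvg_shiftS.
have -> : (fun n =>
      series (fun n => (n`!%:R)^-1 *: powL ((0 +i* t) *: P) n) n.+1)
  = (fun n => (idL X - P)
      + series (fun n => (n`!%:R)^-1 * (0 +i* t) ^+ n) n.+1 *: P).
  apply/funext => n; rewrite /series /= scaler_suml.
  under eq_bigr do rewrite powLZ_idem// scalerDr.
  rewrite big_split /= addrC; congr (_ + _).
    rewrite big_nat_recl//= big1 ?addr0 => [|i _].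
      by rewrite fact0 invr1 !scale1r.
    by rewrite scale0r scaler0.
  by apply: eq_bigr => i _; rewrite scalerA.
apply: cvgD; first exact: cvg_cst.
apply: cvgZr_tmp.
by rewrite (cvg_shiftS (series _)); exact: series_expi_cvg.
Qed.

Lemma opnorm_idL (x : X) : x != 0 -> opnorm (idL X) = 1.
Proof.
move=> x0; apply/eqP; rewrite eq_le; apply/andP; split.
  exact: opnorm_lub.
have xp : 0 < rnorm x.
  rewrite lt_neqAle rnorm_ge0 andbT eq_sym.
  by apply: contra x0 => /eqP/rnorm_eq0/eqP.
by have := opnormP (idL X) x; rewrite -[X in X <= _]mul1r ler_pM2r.
Qed.

(** On a nonzero space exp(it I) = e^{it} I has norm 1; the zero space falls under the
    convention. *)
Lemma hermitian_idL : hermitian_op (idL X).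
Proof.
have [X0|/existsNP[x /eqP x0]] := pselect (forall x : X, x = 0); first by left.
right=> t; rewrite expL_idem ?subrr ?add0r; last exact: blin_ext.
by rewrite normrZ normc_expi mul1r blin_normE (opnorm_idL x).
Qed.

Lemma hermitian_idem_contract P x : hermitian_op P -> P *o P = P ->
  rnorm (x - 2 *: P x) <= rnorm x.
Proof.
move=> [X0 _|hP PP]; first by rewrite (X0 (x - _)) (X0 x).
have := hP pi; rewrite expL_idem// cospi sinpi blin_normE => /complexI o1.
have := opnormP (idL X - P + (-1 +i* 0) *: P) x; rewrite o1 mul1r.
congr (_ <= _); congr rnorm.
have -> : -1 +i* 0 = -1 :> R[i] by apply/eqP; rewrite eq_complex /= oppr0 !eqxx.
by rewrite blinDE blinZE scaleN1r blinDE /= -addrA -opprD scaler_nat mulr2n.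
Qed.

(* The powers of I + N are I + n N; contractions have bounded powers. *)
Lemma contract_nilpotent0 N : (forall x, rnorm (x + N x) <= rnorm x) ->
  N *o N = 0 -> N = 0.
Proof.
move=> cN NN; apply: blin_ext => x.
have NNy y : N (N y) = 0 by have /(congr1 (fun S : blin X X => S y)) := NN.
have iN n : rnorm (x + N x *+ n) <= rnorm x.
  elim: n => [|n]; first by rewrite mulr0n addr0.
  apply: le_trans; have := cN (x + N x *+ n).
  by rewrite blinD -scaler_nat blinZ NNy scaler0 addr0 scaler_nat -addrA
    -mulrSr.
apply: rnorm_eq0; apply/eqP; rewrite eq_le rnorm_ge0 andbT leNgt.
apply/negP => Nx0.
have bN n : rnorm (N x) *+ n <= rnorm x *+ 2.
  have -> : rnorm (N x) *+ n = rnorm ((x + N x *+ n) + (-1) *: x).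
    rewrite scaleN1r addrC addKr.
    have -> : N x *+ n = (n%:R : R[i]) *: N x by rewrite scaler_nat.
    rewrite rnormZ normr_nat.
    by rewrite -(rmorph_nat (real_complex R)) mulr_natl.
  rewrite (le_trans (rnormD _ _))// mulr2n lerD//.
  by rewrite rnormZ normrN1 mul1r.
(* Any n above 2|x| / |Nx| contradicts [bN]. *)
have := bN (Num.truncn (rnorm x *+ 2 / rnorm (N x))).+1.
rewrite -mulr_natl -ler_pdivlMr// leNgt => /negP; apply.
exact: truncnS_gt.
Qed.

(** The two alternatives mean equal ranges and equal kernels. [contract_nilpotent0] is applied to N
    = 2(P - Q). *)
Lemma hermitian_idem_eq P Q : hermitian_op P -> hermitian_op Q ->
  P *o P = P -> Q *o Q = Q ->
  P *o Q = Q /\ Q *o P = P \/ P *o Q = P /\ Q *o P = Q -> P = Q.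
Proof.
move=> hP hQ PP QQ PQ.
have E (S T U : blin X X) y : S *o T = U -> S (T y) = U y by move=> <-.
(* If ST = P, then (I - 2S)(I - 2T) = I + 2(P - T) + 2(P - S). Taking {S, T} = {P, Q}, in the order
   whose product is P, leaves I + 2(P - Q). *)
have reflections S T : hermitian_op S -> hermitian_op T ->
    S *o S = S -> T *o T = T -> S *o T = P ->
    forall x, rnorm (x + 2 *: (P x - T x) + 2 *: (P x - S x)) <= rnorm x.
  move=> hS hT SS TT ST x.
  have := le_trans (hermitian_idem_contract S (x - 2 *: T x) hS SS)
     (hermitian_idem_contract T x hT TT).
  rewrite blinB blinZ (E _ _ _ _ ST); congr (rnorm _ <= _).
  rewrite !scalerBr scaler_nat -!addrA; congr (_ + _).
  by rewrite opprB [2 *: (2 *: _)]scaler_nat mulr2n -[in LHS]addrA addrCA.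
have N0 : (2 : R[i]) *: (P - Q) = 0.
  apply: contract_nilpotent0 => [x|].
    have -> : (2 *: (P - Q)) x = 2 *: (P x - Q x) by [].
    case: PQ => -[PQ QP].
      by have := reflections Q P hQ hP QQ PP QP x; rewrite subrr scaler0 addr0.
    by have := reflections P Q hP hQ PP QQ PQ x; rewrite subrr scaler0 addr0.
  (* In both cases PQ + QP = P + Q, so (P - Q)^2 = 0. *)
  apply: blin_ext => x; rewrite compLE.
  rewrite -[LHS]/(2 *: (P (2 *: (P x - Q x)) - Q (2 *: (P x - Q x)))).
  rewrite !blinZ !blinB (E _ _ _ _ PP) (E _ _ _ _ QQ).
  by case: PQ => -[PQ QP]; rewrite (E _ _ _ _ PQ) (E _ _ _ _ QP) !subrr
    ?scaler0 ?subrr ?scaler0.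
apply/eqP; rewrite -subr_eq0; move/eqP: N0.
by rewrite scaler_eq0 pnatr_eq0.
Qed.

End Hermitian.

(** * Moore-Penrose inverses of T, B and C *)

Section MoorePenrose.
Context {R : realType}.

(** Multiplying by A on the left and L on the right is undone by L and A, as LA = I. This turns the
    two-sided conditions in (v) and (vi) into PQP = P and QPQ = Q. *)
Lemma compress_eq1 {V W : normedModType R[i]} (L : blin W V) (A : blin V W)
    (U : blin W W) : L *o A = idL V ->
  L *o U *o A = idL V <-> A *o L *o (U *o (A *o L)) = A *o L.
Proof.
move=> LA; have -> : A *o L *o (U *o (A *o L)) = A *o (L *o U *o A) *o L.
  by rewrite !compLA.
split=> [->|/(congr1 (fun S => L *o S *o A))]; first by rewrite compL1.
by rewrite !compLA LA !comp1L -!compLA LA !compL1.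
Qed.

(** TS and TS' share the range of T, while ST and S'T share its kernel, so they agree pairwise. Then
    S = STS = STS' = S'TS' = S'. *)
Lemma is_mpinv_unique {X Y : normedModType R[i]} (T : blin X Y)
  (S S' : blin Y X) : is_mpinv T S -> is_mpinv T S' -> S = S'.
Proof.
move=> [TST STS hST hTS] [TST' STS' hST' hTS'].
have eTS : T *o S = T *o S'.
  by apply: hermitian_idem_eq => //; last left; rewrite !compLA -?TST -?TST'.
have eST : S *o T = S' *o T.
  have rT (U : blin Y X) : U *o T *o S *o T = U *o T.
    by rewrite -2!compLA [T *o _]compLA -TST.
  have rT' (U : blin Y X) : U *o T *o S' *o T = U *o T.
    by rewrite -2!compLA [T *o _]compLA -TST'.
  by apply: hermitian_idem_eq => //; last right; rewrite !compLA ?rT ?rT'.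
by rewrite STS -compLA eTS compLA eST -STS'.
Qed.

Lemma mpinvP {X Y : normedModType R[i]} (T : blin X Y) :
  mp_invertible T -> is_mpinv T (mpinv T).
Proof. by move=> [S hS]; exact: (xgetPex 0 (ex_intro _ S hS)). Qed.

Lemma mpinvE {X Y : normedModType R[i]} (T : blin X Y) (S : blin Y X) :
  is_mpinv T S -> mpinv T = S.
Proof.
by move=> hS; apply: (is_mpinv_unique T _ _ _ hS); apply: mpinvP; exists S.
Qed.

Lemma hermitian_mul1 {X Y : normedModType R[i]} (S : blin Y X) (T : blin X Y) :
  S *o T = idL X -> hermitian_op (S *o T).
Proof. by move=> ->; exact: hermitian_idL. Qed.

Context {X Y : normedModType R[i]} {C : blin X Y} {B : blin Y X}.
Context (C_surj : forall y : Y, exists x : X, C x = y) (B_inj : injective B).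

(** Cancelling B on the left and C on the right of B(CSB)C = BC gives CSB = I. The other products,
    B(CS) and (SB)C, are hermitian by assumption on S. *)
Lemma mpinv_factors (S : blin X X) : is_mpinv (B *o C) S ->
  is_mpinv B (C *o S) /\ is_mpinv C (S *o B).
Proof.
move=> [TST STS hST hTS].
have CSB : C *o S *o B = idL Y.
  apply: blin_ext => y; have [x <-] := C_surj y; apply: B_inj.
  by have /(congr1 (fun U : blin X X => U x)) := esym TST.
split; split; rewrite ?(compLA C S B).
- by rewrite -compLA CSB compL1.
- by rewrite CSB comp1L.
- exact: hermitian_mul1.
- by rewrite compLA.
- by rewrite CSB comp1L.
- by rewrite -compLA (compLA C S B) CSB compL1.
- by rewrite -compLA.
- exact: hermitian_mul1.
Qed.

Lemma mpinvK_inj (Bd : blin X Y) : is_mpinv B Bd -> Bd *o B = idL Y.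
Proof.
move=> [BBdB _ _ _]; apply: blin_ext => y; apply: B_inj.
by have /(congr1 (fun U : blin Y X => U y)) := esym BBdB.
Qed.

Lemma mpinvK_surj (Cd : blin Y X) : is_mpinv C Cd -> C *o Cd = idL Y.
Proof.
move=> [CCdC _ _ _]; apply: blin_ext => y; have [x <-] := C_surj y.
by have /(congr1 (fun U : blin X Y => U x)) := esym CCdC.
Qed.

(** The inner factors C C^+ and B^+ B collapse to I, so the two outer products are B B^+ and C^+ C,
    already hermitian. *)
Lemma is_mpinv_comp (Bd : blin X Y) (Cd : blin Y X) :
  is_mpinv B Bd -> is_mpinv C Cd -> is_mpinv (B *o C) (Cd *o Bd).
Proof.
move=> hB hC; have BdB := mpinvK_inj _ hB; have CCd := mpinvK_surj _ hC.
have TTd : B *o C *o (Cd *o Bd) = B *o Bd.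
  by rewrite -compLA (compLA C) CCd comp1L.
have TdT : Cd *o Bd *o (B *o C) = Cd *o C.
  by rewrite -compLA (compLA Bd) BdB comp1L.
case: hB hC => BBdB _ _ hBBd [CCdC _ hCdC _].
split; rewrite ?TTd ?TdT //.
- by rewrite compLA -BBdB.
- by rewrite -compLA (compLA C) CCd comp1L.
Qed.

End MoorePenrose.

Theorem theorem3p4 (R : realType) (X Y : completeNormedModType R[i])
    (T : blin X X) (C : blin X Y) (B : blin Y X)
    (C_surj : forall y : Y, exists x : X, C x = y)
    (B_inj : injective B)
    (T_BC : T = B *o C)
    (T_mp : mp_invertible T) :
  let Bd := mpinv B in
  let Cd := mpinv C in
  let I := idL X in
  (EP T <-> (I - Cd *o C) *o B = 0 /\ C *o (I - B *o Bd) = 0) /\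
  (EP T <-> Bd *o (I - Cd *o C) = 0 /\ C *o (I - B *o Bd) = 0) /\
  (EP T <-> (I - Cd *o C) *o B = 0 /\ (I - B *o Bd) *o Cd = 0) /\
  (EP T <-> Bd *o (I - Cd *o C) = 0 /\ (I - B *o Bd) *o Cd = 0) /\
  (EP T <-> C *o (I - B *o Bd) = 0 /\ Bd *o (I - Cd *o C) *o B = 0) /\
  (EP T <-> Bd *o (I - Cd *o C) = 0 /\ C *o (I - B *o Bd) *o Cd = 0).
Proof.
move=> Bd Cd I.
have hT := mpinvP _ T_mp; rewrite {1}T_BC in hT.
have [hB0 hC0] := mpinv_factors C_surj B_inj _ hT.
(* The explicit witnesses rule out the default value 0 of [mpinv] for B and C. *)
have hB : is_mpinv B Bd by apply: mpinvP; exists (C *o mpinv T).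
have hC : is_mpinv C Cd by apply: mpinvP; exists (mpinv T *o B).
have Td : mpinv T = Cd *o Bd.
  by rewrite T_BC; apply: mpinvE; exact: is_mpinv_comp.
have BdB := mpinvK_inj B_inj _ hB; have CCd := mpinvK_surj C_surj _ hC.
have [BBdB BdBBd _ hP] := hB; have [CCdC CdCCd hQ _] := hC.
have PP : (B *o Bd) *o (B *o Bd) = B *o Bd by rewrite compLA -BBdB.
have QQ : (Cd *o C) *o (Cd *o C) = Cd *o C by rewrite compLA -CdCCd.
have EP_eq : EP T <-> B *o Bd = Cd *o C.
  have -> : B *o Bd = T *o mpinv T.
    by rewrite Td T_BC -compLA (compLA C) CCd comp1L.
  have -> : Cd *o C = mpinv T *o T.
    by rewrite Td T_BC -compLA (compLA Bd) BdB comp1L.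
  by split=> [[]|].
have sub0 (V W : normedModType R[i]) (U U' : blin V W) : U - U' = 0 <-> U' = U.
  by split=> [/eqP|->]; rewrite ?subrr// subr_eq0 => /eqP.
(* Multiplying by the missing factor gives an identity between P and Q, and B^+ B = I or C C^+ = I
   cancels it again. [E1] to [E4] read QP = P, QP = Q, PQ = P, PQ = Q. *)
have E1 : (I - Cd *o C) *o B = 0 <-> Cd *o C *o (B *o Bd) = B *o Bd.
  rewrite compLBl comp1L sub0; split=> [e|e]; first by rewrite compLA e.
  by rewrite [in RHS]BBdB -e -!compLA BdB compL1.
have E2 : C *o (I - B *o Bd) = 0 <-> Cd *o C *o (B *o Bd) = Cd *o C.
  rewrite compLBr compL1 sub0; split=> [e|e]; first by rewrite -compLA e.
  by rewrite [in RHS]CCdC -[in RHS]compLA -e !compLA CCd comp1L.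
have E3 : Bd *o (I - Cd *o C) = 0 <-> B *o Bd *o (Cd *o C) = B *o Bd.
  rewrite compLBr compL1 sub0; split=> [e|e]; first by rewrite -compLA e.
  by rewrite [in RHS]BdBBd -[in RHS]compLA -e !compLA BdB comp1L.
have E4 : (I - B *o Bd) *o Cd = 0 <-> B *o Bd *o (Cd *o C) = Cd *o C.
  rewrite compLBl comp1L sub0; split=> [e|e]; first by rewrite compLA e.
  by rewrite [in RHS]CdCCd -e -!compLA CCd compL1.
have E5 : Bd *o (I - Cd *o C) *o B = 0 <->
    B *o Bd *o (Cd *o C *o (B *o Bd)) = B *o Bd.
  by rewrite compLBr compLBl compL1 BdB sub0 compress_eq1.
have E6 : C *o (I - B *o Bd) *o Cd = 0 <->
    Cd *o C *o (B *o Bd *o (Cd *o C)) = Cd *o C.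
  by rewrite compLBr compLBl compL1 CCd sub0 compress_eq1.
rewrite E1 E2 E3 E4 E5 E6 EP_eq.
have idem_eq := hermitian_idem_eq _ _ hP hQ PP QQ.
set P := B *o Bd in PP idem_eq *; set Q := Cd *o C in QQ idem_eq *.
(* (i) and (iv) equate one product with both P and Q; (ii) says that the kernels agree, (iii) that
   the ranges do. *)
split; first by split=> [->|[QP PQ]] //; rewrite -QP.
split; first by split=> [->|[PQ QP]] //; apply: idem_eq; right.
split; first by split=> [->|[QP PQ]] //; apply: idem_eq; left.
split; first by split=> [->|[PQ QP]] //; rewrite -PQ.
(* In (v), QP = Q reduces PQP = P to PQ = P; in (vi), PQ = P reduces QPQ = Q to QP = Q. Both times
   the kernels agree. *)
split; split=> [->|[QP]]; rewrite ?QQ //.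
  by rewrite QP => PQ; apply: idem_eq; right.
by rewrite QP => PQ; apply: idem_eq; right.
Qed.
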